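(* Let $H$ be a compact quantum group with antipode $S$, normal integral $\varphi$ and associated inner product $\langle x,y\rangle=\varphi(S(y^\circ)x)$. Let $\mathcal{N}$ be the Nakayama automorphism and $\alpha$ the modular function. (1) The adjoint of the operator $S:H\to H$ is $S^*=S\mathcal{N}^{-1}=\mathcal{N}S=S^{-1}\star\alpha^{-1}$. (2) $SS^*=S^2\mathcal{N}^{-1}=\mathcal{N}^{-1}S^2=\mathrm{id}\star\alpha^{-1}$ and $S^*S=\mathcal{N}S^2=S^2\mathcal{N}=\alpha\star\mathrm{id}$. (3) The operator $S$ is normal if and only if $S^4=\mathrm{id}$ and $\alpha^2=\varepsilon$.
   Context: Everything is over $\mathbb{C}$. A $\circ$-structure on a coalgebra is a conjugate linear involution $c\mapsto c^\circ$ with $\Delta(c^\circ)=\sum c_2^\circ\otimes c_1^\circ$. A $\circ$-Hopf algebra is a Hopf algebra $H$ with a $\circ$-structure on its coalgebra such that $(xy)^\circ=x^\circ y^\circ$. A unitary inner product on a right $H$-comodule $V$ (coaction $v\mapsto\sum v_0\otimes v_1$) is an inner product (linear in the first, conjugate linear in the second variable) with $\sum\langle u_0,v\rangle u_1=\sum\langle u,v_0\rangle v_1^\circ$ for all $u,v$. A compact quantum group is a $\circ$-Hopf algebra such that every right $H$-comodule admits a unitary inner product. Such an $H$ is cosemisimple (the direct sum of its simple subcoalgebras); the normal integral $\varphi:H\to\mathbb{C}$ is the projection onto the simple subcoalgebra $\mathbb{C}1\cong\mathbb{C}$ along the sum of the others, and $\langle x,y\rangle=\varphi(S(y^\circ)x)$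 is an inner product on $H$. Adjoints are with respect to it; $S$ is normal if $SS^*=S^*S$. The Nakayama automorphism $\mathcal{N}$ is the algebra automorphism of $H$ with $\varphi(xy)=\varphi(y\,\mathcal{N}(x))$ for all $x,y$; the modular function is $\alpha=\varepsilon\mathcal{N}$, an algebra morphism $H\to\mathbb{C}$ with convolution inverse $\alpha^{-1}=\alpha S$; $\alpha^2$ is the convolution square. For $\tau\in H^*$ and a linear map $L:H\to H$: $(\tau\star L)(x)=\sum\tau(x_1)L(x_2)$ and $(L\star\tau)(x)=\sum L(x_1)\tau(x_2)$. *)

(* Defs.v *)
From HB Require Import structures.
From mathcomp Require Import all_boot all_order all_algebra sesquilinear.
From mathcomp Require Import complex.
From mathcomp Require Import boolp classical_sets functions reals.

Set Implicit Arguments.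
Unset Strict Implicit.
Unset Printing Implicit Defensive.

Import Order.TTheory GRing.Theory Num.Theory.

Local Open Scope quotient_scope.
Local Open Scope ring_scope.

Reserved Notation "u \ox v" (at level 40, left associativity).
Reserved Notation "\sweedler_ ( x , y <- t ) E"
  (at level 41, E at level 41, t at level 49, x name, y name,
   format "'[' \sweedler_ ( x ,  y  <-  t ) '/  '  E ']'").
Reserved Notation "x ^circ" (at level 1, format "x ^circ").

(* The tensor product of U and V is the quotient of the finite formal sums
   sum_i (u_i, v_i), represented by sequences of pairs, by the relation
   "equal under every balanced biadditive map into an abelian group".  Using
   balanced maps rather than bilinear ones makes maps such as
   (x, y) |-> y^circ \ox x^circ, which are conjugate linear in both variables,
   directly eligible for the universal property. *)

Section Tensor.
Variables (R : comNzRingType) (U V : lmodType R).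

Definition balanced (W : zmodType) (B : U -> V -> W) : Prop :=
  [/\ forall u u' v, B (u + u') v = B u v + B u' v,
      forall u v v', B u (v + v') = B u v + B u v' &
      forall a u v, B (a *: u) v = B u (a *: v)].

Definition tensor_rel (s t : seq (U * V)) : bool :=
  `[< forall (W : zmodType) (B : U -> V -> W), balanced B ->
      \sum_(p <- s) B p.1 p.2 = \sum_(p <- t) B p.1 p.2 >].

Lemma tensor_rel_refl : reflexive tensor_rel.
Proof. by move=> s; apply/asboolP. Qed.

Lemma tensor_rel_sym : symmetric tensor_rel.
Proof.
by move=> s t; apply/asboolP/asboolP => st W B bB; rewrite st.
Qed.

Lemma tensor_rel_trans : transitive tensor_rel.
Proof.
move=> t s r /asboolP st /asboolP tr; apply/asboolP => W B bB.
by rewrite st // tr.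
Qed.

Canonical tensor_equiv :=
  EquivRel tensor_rel tensor_rel_refl tensor_rel_sym tensor_rel_trans.

Definition tensor : Type := {eq_quot tensor_equiv}.

HB.instance Definition _ : EqQuotient _ tensor_equiv tensor :=
  EqQuotient.on tensor.
HB.instance Definition _ := Choice.on tensor.

Implicit Types (s t : seq (U * V)) (x y z : tensor).

Lemma eq_tensorP s t :
  \pi_tensor s = \pi_tensor t <->
  (forall (W : zmodType) (B : U -> V -> W), balanced B ->
     \sum_(p <- s) B p.1 p.2 = \sum_(p <- t) B p.1 p.2).
Proof. by split=> [/eqmodP/asboolP|st]; last by apply/eqmodP/asboolP. Qed.

Lemma balanced0l (W : zmodType) (B : U -> V -> W) v : balanced B -> B 0 v = 0.
Proof. by case=> BD _ _; apply: (addrI (B 0 v)); rewrite -BD !addr0. Qed.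

Lemma balancedNl (W : zmodType) (B : U -> V -> W) u v :
  balanced B -> B (- u) v = - B u v.
Proof.
move=> bB; apply: (addrI (B u v)); rewrite subrr.
by have [<- _ _] := bB; rewrite subrr balanced0l.
Qed.

(* [tlift B] is the map on the tensor product induced by [B]; it is meaningful
   when [B] is balanced (see [tlift_tens] and [tliftD]). *)
Definition tlift (W : zmodType) (B : U -> V -> W) (x : tensor) : W :=
  \sum_(p <- repr x) B p.1 p.2.

Lemma tlift_pi (W : zmodType) (B : U -> V -> W) s : balanced B ->
  tlift B (\pi_tensor s) = \sum_(p <- s) B p.1 p.2.
Proof. by move=> bB; apply/eq_tensorP: (W) (B) bB; rewrite reprK. Qed.

Definition tens (u : U) (v : V) : tensor := \pi_tensor [:: (u, v)].

Definition tensor_zero : tensor := \pi_tensor [::].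
Definition tensor_add x y : tensor := \pi_tensor (repr x ++ repr y).
Definition tensor_opp x : tensor :=
  \pi_tensor [seq (- p.1, p.2) | p <- repr x].
Definition tensor_scale (a : R) x : tensor :=
  \pi_tensor [seq (a *: p.1, p.2) | p <- repr x].

Lemma tensor_eqP x y :
  (forall (W : zmodType) (B : U -> V -> W), balanced B ->
     tlift B x = tlift B y) -> x = y.
Proof.
by move=> xy; rewrite -[x]reprK -[y]reprK; apply/eq_tensorP => W B /xy.
Qed.

Lemma tlift0 (W : zmodType) (B : U -> V -> W) :
  balanced B -> tlift B tensor_zero = 0.
Proof. by move=> bB; rewrite tlift_pi // big_nil. Qed.

Lemma tlift_add (W : zmodType) (B : U -> V -> W) x y :
  balanced B -> tlift B (tensor_add x y) = tlift B x + tlift B y.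
Proof. by move=> bB; rewrite tlift_pi // big_cat. Qed.

Lemma tlift_opp (W : zmodType) (B : U -> V -> W) x :
  balanced B -> tlift B (tensor_opp x) = - tlift B x.
Proof.
move=> bB; rewrite tlift_pi // big_map /= -sumrN.
by apply: eq_bigr => p _; rewrite balancedNl.
Qed.

Lemma balanced_scale (W : zmodType) (B : U -> V -> W) a :
  balanced B -> balanced (fun u v => B (a *: u) v).
Proof.
case=> BDl BDr BZ; split=> [u u' v|u v v'|b u v].
- by rewrite scalerDr BDl.
- exact: BDr.
- by rewrite scalerA mulrC -scalerA BZ.
Qed.

Lemma tlift_scale (W : zmodType) (B : U -> V -> W) a x : balanced B ->
  tlift B (tensor_scale a x) = tlift (fun u v => B (a *: u) v) x.
Proof. by move=> bB; rewrite tlift_pi // big_map. Qed.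

Lemma tensor_addA : associative tensor_add.
Proof.
by move=> x y z; apply: tensor_eqP => W B bB; rewrite !tlift_add // addrA.
Qed.

Lemma tensor_addC : commutative tensor_add.
Proof.
by move=> x y; apply: tensor_eqP => W B bB; rewrite !tlift_add // addrC.
Qed.

Lemma tensor_add0 : left_id tensor_zero tensor_add.
Proof.
by move=> x; apply: tensor_eqP => W B bB; rewrite tlift_add // tlift0 // add0r.
Qed.

Lemma tensor_addN : left_inverse tensor_zero tensor_opp tensor_add.
Proof.
move=> x; apply: tensor_eqP => W B bB.
by rewrite tlift_add // tlift_opp // tlift0 // addNr.
Qed.

HB.instance Definition _ := GRing.isZmodule.Build tensor
  tensor_addA tensor_addC tensor_add0 tensor_addN.

Lemma tensor_scaleA a b x :
  tensor_scale a (tensor_scale b x) = tensor_scale (a * b) x.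
Proof.
apply: tensor_eqP => W B bB.
rewrite !tlift_scale //; last exact: balanced_scale.
by apply: eq_bigr => p _; rewrite scalerA.
Qed.

Lemma tensor_scale1 : left_id 1 tensor_scale.
Proof.
move=> x; apply: tensor_eqP => W B bB; rewrite tlift_scale //.
by apply: eq_bigr => p _; rewrite scale1r.
Qed.

Lemma tensor_scaleDr : right_distributive tensor_scale +%R.
Proof.
move=> a x y; apply: tensor_eqP => W B bB.
rewrite tlift_scale // !tlift_add // ?tlift_scale //.
exact: balanced_scale.
Qed.

Lemma tensor_scaleDl x : {morph tensor_scale^~ x : a b / a + b}.
Proof.
move=> a b; apply: tensor_eqP => W B bB.
rewrite tlift_add // !tlift_scale // /tlift -big_split /=.
by apply: eq_bigr => p _; rewrite scalerDl; have [-> _ _] := bB.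
Qed.

HB.instance Definition _ := GRing.Zmodule_isLmodule.Build R tensor
  tensor_scaleA tensor_scale1 tensor_scaleDr tensor_scaleDl.

Lemma tlift_tens (W : zmodType) (B : U -> V -> W) u v :
  balanced B -> tlift B (tens u v) = B u v.
Proof. by move=> bB; rewrite tlift_pi // big_seq1. Qed.

Lemma tliftD (W : zmodType) (B : U -> V -> W) x y :
  balanced B -> tlift B (x + y) = tlift B x + tlift B y.
Proof. exact: tlift_add. Qed.

Lemma tens_balanced : balanced tens.
Proof.
split=> [u u' v|u v v'|a u v]; apply: tensor_eqP => W B bB;
  rewrite ?tliftD // !tlift_tens //; by have [BDl BDr BZ] := bB.
Qed.

Lemma scale_tens a u v : a *: tens u v = tens (a *: u) v.
Proof.
apply: tensor_eqP => W B bB.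
by rewrite tlift_scale // !tlift_tens //; apply: balanced_scale.
Qed.

Lemma tensor_sum x : x = \sum_(p <- repr x) tens p.1 p.2.
Proof.
apply: tensor_eqP => W B bB.
have lift_sum (s : seq (U * V)) :
    tlift B (\sum_(p <- s) tens p.1 p.2) = \sum_(p <- s) B p.1 p.2.
  elim: s => [|p s IHs]; first by rewrite !big_nil tlift0.
  by rewrite !big_cons tliftD // tlift_tens // IHs.
by rewrite lift_sum.
Qed.

End Tensor.

Notation "u \ox v" := (tens u v) : ring_scope.
Notation "\sweedler_ ( x , y <- t ) E" := (tlift (fun x y => E) t) : ring_scope.

HB.mixin Record Lmodule_isCoalgebra (R : comNzRingType) C of
    GRing.Lmodule R C := {
  comul : {linear C -> tensor C C};
  counit : {scalar C};
  comulA : forall c,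
    \sweedler_(x, y <- comul c) \sweedler_(x1, x2 <- comul x) (x1 \ox x2) \ox y =
    \sweedler_(x, y <- comul c) \sweedler_(y1, y2 <- comul y) (x \ox y1) \ox y2;
  comul_counitl : forall c, \sweedler_(x, y <- comul c) counit x *: y = c;
  comul_counitr : forall c, \sweedler_(x, y <- comul c) counit y *: x = c
}.

#[short(type="coalgebraType")]
HB.structure Definition Coalgebra (R : comNzRingType) :=
  {C of GRing.Lmodule R C & Lmodule_isCoalgebra R C}.

HB.mixin Record Coalgebra_isHopf (R : comNzRingType) H of
    GRing.Algebra R H & Coalgebra R H := {
  comul1 : comul (1 : H) = 1 \ox 1 :> tensor H H;
  comulM : forall x y : H, comul (x * y) =
    \sweedler_(x1, x2 <- comul x) \sweedler_(y1, y2 <- comul y)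
      (x1 * y1) \ox (x2 * y2) :> tensor H H;
  counit1 : counit (1 : H) = 1;
  counitM : forall x y : H, counit (x * y) = counit x * counit y;
  antipode : {linear H -> H};
  antipodel : forall x : H,
    \sweedler_(x1, x2 <- comul x) antipode x1 * x2 = (counit x)%:A;
  antipoder : forall x : H,
    \sweedler_(x1, x2 <- comul x) x1 * antipode x2 = (counit x)%:A
}.

#[short(type="hopfAlgType")]
HB.structure Definition HopfAlgebra (R : comNzRingType) :=
  {H of GRing.Algebra R H & Coalgebra R H & Coalgebra_isHopf R H}.

(* [K] plays the role of the complex numbers, with conjugation [Num.conj]. *)

HB.mixin Record Coalgebra_isCirc (K : numClosedFieldType) C of
    Coalgebra K C := {
  circ : C -> C;
  circD : {morph circ : x y / x + y};
  circZ : forall (a : K) x, circ (a *: x) = a^* *: circ x;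
  circK : involutive circ;
  comul_circ : forall c : C, comul (circ c) =
    \sweedler_(c1, c2 <- comul c) circ c2 \ox circ c1 :> tensor C C
}.

#[short(type="circCoalgebraType")]
HB.structure Definition CircCoalgebra (K : numClosedFieldType) :=
  {C of Coalgebra K C & Coalgebra_isCirc K C}.

Notation "x ^circ" := (circ x) : ring_scope.

HB.mixin Record Hopf_isCircHopf (K : numClosedFieldType) H of
    HopfAlgebra K H & CircCoalgebra K H := {
  circM : {morph @circ K H : x y / x * y}
}.

#[short(type="circHopfAlgType")]
HB.structure Definition CircHopfAlgebra (K : numClosedFieldType) :=
  {H of HopfAlgebra K H & CircCoalgebra K H & Hopf_isCircHopf K H}.

Definition right_comodule (R : comNzRingType) (C : coalgebraType R)
    (V : lmodType R) (rho : {linear V -> tensor V C}) : Prop :=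
  (forall v,
    \sweedler_(v0, v1 <- rho v) \sweedler_(w0, w1 <- rho v0) (w0 \ox w1) \ox v1 =
    \sweedler_(v0, v1 <- rho v) \sweedler_(x1, x2 <- comul v1) (v0 \ox x1) \ox x2)
  /\ (forall v, \sweedler_(v0, v1 <- rho v) counit v1 *: v0 = v).

(* An element of [{dot V for Num.conj}] is a positive definite Hermitian form,
   linear in its first variable. *)
Definition unitary_product (K : numClosedFieldType) (H : circCoalgebraType K)
    (V : lmodType K) (rho : {linear V -> tensor V H})
    (ip : {dot V for @Num.conj K}) : Prop :=
  forall u v : V,
    \sweedler_(u0, u1 <- rho u) ip u0 v *: u1 =
    \sweedler_(v0, v1 <- rho v) ip u v0 *: v1^circ.

HB.mixin Record CircHopf_isCompact (K : numClosedFieldType) H of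
    CircHopfAlgebra K H := {
  unitarizable : forall (V : lmodType K) (rho : {linear V -> tensor V H}),
    right_comodule rho ->
    exists ip : {dot V for @Num.conj K}, unitary_product rho ip
}.

#[short(type="compactQuantumGroupType")]
HB.structure Definition CompactQuantumGroup (K : numClosedFieldType) :=
  {H of CircHopfAlgebra K H & CircHopf_isCompact K H}.

Section NormalIntegral.
Local Open Scope classical_set_scope.
Variables (R : comNzRingType).

Definition subcoalgebra (C : coalgebraType R) (D : set C) : Prop :=
  [/\ D 0,
      forall (a : R) x y, D x -> D y -> D (a *: x + y) &
      forall x, D x -> exists s : seq (C * C),
        (forall p, p \in s -> D p.1 /\ D p.2) /\
        comul x = \sum_(p <- s) p.1 \ox p.2].

Definition simple_subcoalgebra (C : coalgebraType R) (D : set C) : Prop :=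
  [/\ subcoalgebra D, D <> [set 0] &
      forall E : set C, subcoalgebra E -> E `<=` D -> E = [set 0] \/ E = D].

Variable H : hopfAlgType R.

Definition unit_subcoalgebra : set H := [set a%:A | a in [set: R]].

Definition other_simple_sum : set H :=
  [set x | exists s : seq H, x = \sum_(y <- s) y /\
    forall y, y \in s -> exists D : set H,
      [/\ simple_subcoalgebra D, D <> unit_subcoalgebra & D y]].

(* [phi] is the projection onto the simple subcoalgebra spanned by 1,
   identified with the scalars, along the sum of the other ones. *)
Definition normal_integral (phi : {scalar H}) : Prop :=
  [/\ phi 1 = 1,
      forall y, other_simple_sum y -> phi y = 0 &
      forall x, other_simple_sum (x - (phi x)%:A)].

End NormalIntegral.

Definition circ_product (K : numClosedFieldType) (H : circHopfAlgType K)
    (phi : H -> K) (x y : H) : K := phi (antipode (y^circ) * x).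

Definition adjoint (K : numClosedFieldType) (H : lmodType K)
    (ip : H -> H -> K) (f g : H -> H) : Prop :=
  forall x y, ip (f x) y = ip x (g y).

Definition nakayama (R : comNzRingType) (H : algType R) (phi : H -> R)
    (N : {lrmorphism H -> H}) : Prop :=
  bijective N /\ forall x y, phi (x * y) = phi (y * N x).

(* Genuine inverse when [f] is bijective; junk otherwise. *)
Definition inverse (V : zmodType) (f : V -> V) : V -> V :=
  'pinv_(fun=> 0) [set: V] f.

Lemma inverseK (V : zmodType) (f : V -> V) :
  bijective f -> cancel f (inverse f) /\ cancel (inverse f) f.
Proof.
move=> bf; have [g fK gK] := bf; split=> x; rewrite /inverse.
  by rewrite pinvKV ?in_setT // => a b _ _; apply: (can_inj fK).
by rewrite pinvK // inE /=; exists (g x).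
Qed.

Definition conv (R : comNzRingType) (H : coalgebraType R)
    (tau sigma : H -> R) : H -> R :=
  fun x => \sweedler_(x1, x2 <- comul x) tau x1 * sigma x2.

Definition convl (R : comNzRingType) (H : coalgebraType R)
    (tau : H -> R) (L : H -> H) : H -> H :=
  fun x => \sweedler_(x1, x2 <- comul x) tau x1 *: L x2.

Definition convr (R : comNzRingType) (H : coalgebraType R)
    (L : H -> H) (tau : H -> R) : H -> H :=
  fun x => \sweedler_(x1, x2 <- comul x) tau x2 *: L x1.

(* The convolution inverse of the modular function alpha is alpha \o antipode. *)
Lemma modular_convV (R : comNzRingType) (H : hopfAlgType R)
    (N : {lrmorphism H -> H}) (alpha : H -> R := counit \o N) (x : H) :
  conv alpha (alpha \o antipode) x = counit x /\
  conv (alpha \o antipode) alpha x = counit x.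
Proof.
have alpha_alg a : alpha a%:A = a.
  by rewrite /alpha /= linearZ rmorph1 linearZ /= counit1 mulr1.
split; [rewrite -[RHS]alpha_alg -antipoder | rewrite -[RHS]alpha_alg -antipodel];
  rewrite /alpha /conv /tlift /= !raddf_sum /=;
  by apply: eq_bigr => p _; rewrite rmorphM counitM.
Qed.

(* Main.v *)
Require Import Defs.
From HB Require Import structures.
From mathcomp Require Import all_boot all_order all_algebra.
From mathcomp Require Import complex.
From mathcomp Require Import boolp.
From mathcomp Require Import reals.

Set Implicit Arguments.
Unset Strict Implicit.
Unset Printing Implicit Defensive.

Import GRing.Theory Num.Theory.

Local Open Scope ring_scope.

(* Invariance of phi gives
     sum phi(x2 y) S(x1) = sum phi(x y2) y1,
     sum phi(x1 y) x2 = sum phi(x y1) S(y2).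
   The first one shows that J = {u | phi(w u) = 0 for all w} has
   Delta(J) in H \ox J, and phi(1) = 1 then forces J = 0, so that an element of
   H may be identified by testing it against all the functionals phi(w _).
   Combining the two formulas with phi(x y) = phi(y N(x)), such tests yield
   phi S = phi, N S N = S and the convolution formulas N = S^2 * alpha and
   S^2 N = alpha * id.  Together with S(S(x^circ)^circ) = x and
   N(x^circ) = N(x)^circ, the latter being due to phi(x^circ) = conj(phi(x)),
   they imply all the claims. *)

(** * Maps out of a tensor product *)

Section TensorMaps.
Variables (R : comNzRingType) (U V : lmodType R).

Lemma tlift_sum (W : zmodType) (B : U -> V -> W) I (s : seq I)
    (F : I -> tensor U V) : balanced B ->
  tlift B (\sum_(i <- s) F i) = \sum_(i <- s) tlift B (F i).
Proof.
move=> bB; elim: s => [|i s IHs]; first by rewrite !big_nil /= tlift0.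
by rewrite !big_cons tliftD // IHs.
Qed.

Lemma tlift_sum_tens (W : zmodType) (B : U -> V -> W) I (s : seq I) F G :
  balanced B ->
  tlift B (\sum_(i <- s) F i \ox G i) = \sum_(i <- s) B (F i) (G i).
Proof.
by move=> bB; rewrite tlift_sum //; apply: eq_bigr => i _; rewrite tlift_tens.
Qed.

Lemma balanced_sum (W : zmodType) I (s : seq I) (B : I -> U -> V -> W) :
  (forall i, balanced (B i)) -> balanced (fun u v => \sum_(i <- s) B i u v).
Proof.
move=> bB; split=> [u u' v|u v v'|a u v].
- by rewrite -big_split; apply: eq_bigr => i _; have [-> _ _] := bB i.
- by rewrite -big_split; apply: eq_bigr => i _; have [_ -> _] := bB i.
- by apply: eq_bigr => i _; have [_ _ ->] := bB i.
Qed.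

End TensorMaps.

(* Gaussian elimination: a pure tensor whose second factor survives some
   functional can be eliminated from the sum. *)
Lemma tensor_sum_ker (K : fieldType) (U V : lmodType K) (I : Type)
    (f : I -> {scalar V}) (s : seq (U * V)) :
  (forall i, \sum_(p <- s) f i p.2 *: p.1 = 0) ->
  exists2 s' : seq (U * V), \sum_(p <- s) p.1 \ox p.2 =
      \sum_(p <- s') p.1 \ox p.2 :> tensor U V &
    forall p, p \in s' -> forall i, f i p.2 = 0.
Proof.
have [n] := ubnP (size s); elim: n s => // n IHn s ltsn s0.
have [/(_ _ _)ker_s|] := pselect (forall p, p \in s -> forall i, f i p.2 = 0).
  by exists s.
move=> /existsNP[p /not_implyP[ps /existsNP[i /eqP fp0]]].
pose c (q : U * V) := f i q.2 / f i p.2.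
pose s1 := [seq (q.1, q.2 - c q *: p.2) | q <- rem p s].
have [tDr tZ] :
    (forall u v v', u \ox (v + v') = u \ox v + u \ox v' :> tensor U V) /\
    (forall a (u : U) (v : V), (a *: u) \ox v = u \ox (a *: v)).
  by have [_ ? ?] := tens_balanced U V.
have ss1 : \sum_(p <- s) p.1 \ox p.2 =
    \sum_(p <- s1) p.1 \ox p.2 :> tensor U V.
  have p1E : p.1 = - \sum_(q <- rem p s) c q *: q.1.
    have := s0 i; rewrite (big_rem _ ps) /= => /eqP; rewrite addr_eq0 => /eqP E.
    apply: (scalerI fp0); rewrite E scalerN scaler_sumr; congr (- _).
    by apply: eq_bigr => q _; rewrite scalerA /c mulrCA mulfV // mulr1.
  rewrite (big_rem _ ps) /= big_map /= {1}p1E.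
  have -> : (- \sum_(q <- rem p s) c q *: q.1) \ox p.2 =
      \sum_(q <- rem p s) q.1 \ox (- c q *: p.2).
    elim: (rem p s) => [|q r IHr].
      by rewrite !big_nil oppr0 (balanced0l _ (tens_balanced U V)).
    rewrite !big_cons opprD -IHr.
    have [-> _ _] := tens_balanced U V.
    by rewrite -scaleNr tZ.
  by rewrite -big_split; apply: eq_bigr => q _; rewrite /= addrC -tDr scaleNr.
have [|j|s' s1s' ker_s'] := IHn s1.
- rewrite size_map size_rem //; case: (s) ps ltsn => //.
- have fb : balanced (fun (u : U) (v : V) => f j v *: u).
    split=> [u u' v|u v v'|a u v]; first exact: scalerDr.
      by rewrite linearD scalerDl.
    by rewrite scalarZ !scalerA mulrC.
  by rewrite -[RHS](s0 j) -!(tlift_sum_tens _ _ _ fb) ss1.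
by exists s' => //; rewrite ss1.
Qed.

(** * Calculus with Sweedler sums *)

Section TensorCombinators.
Variables (R : comNzRingType) (U V : lmodType R).

Lemma eq_tlift (W : zmodType) (B B' : U -> V -> W) (t : tensor U V) :
  (forall u v, B u v = B' u v) -> tlift B t = tlift B' t.
Proof. by move=> BB'; apply: eq_bigr. Qed.

(** [tlift] is a finite sum over a representative, so it commutes with anything additive. *)
Lemma raddf_tlift (W W' : zmodType) (f : {additive W -> W'})
    (B : U -> V -> W) (t : tensor U V) :
  f (tlift B t) = tlift (fun u v => f (B u v)) t.
Proof. exact: raddf_sum. Qed.

Lemma mulr_tliftl (A : pzRingType) (B : U -> V -> A) (t : tensor U V) a :
  tlift B t * a = tlift (fun u v => B u v * a) t.
Proof. exact: mulr_suml. Qed.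

Lemma mulr_tliftr (A : pzRingType) (B : U -> V -> A) (t : tensor U V) a :
  a * tlift B t = tlift (fun u v => a * B u v) t.
Proof. exact: mulr_sumr. Qed.

Lemma scaler_tliftl (W : lmodType R) (B : U -> V -> R) (t : tensor U V)
    (w : W) : tlift B t *: w = tlift (fun u v => B u v *: w) t.
Proof. exact: scaler_suml. Qed.

Lemma scalar_tlift (W : lmodType R) (f : {scalar W}) (a : U -> V -> R)
    (B : U -> V -> W) (t : tensor U V) :
  f (tlift (fun u v => a u v *: B u v) t) =
  tlift (fun u v => a u v * f (B u v)) t.
Proof. by rewrite raddf_tlift; apply: eq_tlift => u v; apply: scalarZ. Qed.

Lemma scalar_mulr_tlift (A : algType R) (f : {scalar A}) w (a : U -> V -> R)
    (B : U -> V -> A) (t : tensor U V) :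
  f (w * tlift (fun u v => a u v *: B u v) t) =
  tlift (fun u v => a u v * f (w * B u v)) t.
Proof. exact: (scalar_tlift (f \o (w \*o idfun))). Qed.

(** Combined with [scalar_tlift], this changes the leg that is contracted first: a sum of products
    of one functional per leg is either functional applied to the contraction by the other. *)
Lemma eq_tliftC (a b : U -> V -> R) (t : tensor U V) :
  tlift (fun u v => a u v * b u v) t = tlift (fun u v => b u v * a u v) t.
Proof. by apply: eq_tlift => u v; rewrite mulrC. Qed.

Lemma tlift_tlift (U' V' : lmodType R) (W : zmodType) (B : U -> V -> W)
    (G : U' -> V' -> tensor U V) (t : tensor U' V') : balanced B ->
  tlift B (tlift G t) = tlift (fun u' v' => tlift B (G u' v')) t.
Proof. exact: tlift_sum. Qed.

Lemma exchange_tlift (U' V' : lmodType R) (W : zmodType)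
    (B : U -> V -> U' -> V' -> W) (t : tensor U V) (t' : tensor U' V') :
  tlift (fun u v => tlift (B u v) t') t =
  tlift (fun u' v' => tlift (fun u v => B u v u' v') t) t'.
Proof. exact: exchange_big. Qed.

Lemma balanced_tlift (U' V' : lmodType R) (W : zmodType)
    (B : U -> V -> U' -> V' -> W) (t : tensor U' V') :
  (forall u' v', balanced (fun u v => B u v u' v')) ->
  balanced (fun u v => tlift (B u v) t).
Proof. by move=> bB; apply: balanced_sum => p; apply: bB. Qed.

Lemma balanced_tliftl (U' V' : lmodType R) (W : zmodType) (B : U -> V -> W)
    (G : U' -> V' -> U) (t : tensor U' V') v : balanced B ->
  B (tlift G t) v = tlift (fun u' v' => B (G u' v') v) t.
Proof.
move=> bB; rewrite /tlift; elim: (repr t) => [|p s IHs].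
  by rewrite !big_nil balanced0l.
by rewrite !big_cons -IHs; have [-> _ _] := bB.
Qed.

Lemma balanced_tliftr (U' V' : lmodType R) (W : zmodType) (B : U -> V -> W)
    (G : U' -> V' -> V) (t : tensor U' V') u : balanced B ->
  B u (tlift G t) = tlift (fun u' v' => B u (G u' v')) t.
Proof.
move=> bB; have [_ BD _] := bB; rewrite /tlift; elim: (repr t) => [|p s IHs].
  by rewrite !big_nil; apply: (addrI (B u 0)); rewrite -BD !addr0.
by rewrite !big_cons -IHs BD.
Qed.

End TensorCombinators.

(** * Coassociativity in three variables *)

Section Coassociativity.
Variables (R : comNzRingType) (C : coalgebraType R).

(** A map of three variables that is balanced in each adjacent pair factors through the triple
    tensor product in which [comulA] lives. *)
Lemma coassoc (W : zmodType) (B : C -> C -> C -> W) c :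
    (forall z, balanced (fun x y => B x y z)) ->
    (forall x, balanced (fun y z => B x y z)) ->
  \sweedler_(x, z <- comul c) \sweedler_(x1, x2 <- comul x) B x1 x2 z =
  \sweedler_(x, z <- comul c) \sweedler_(z1, z2 <- comul z) B x z1 z2.
Proof.
move=> bl br.
pose F (t : tensor C C) z := tlift (fun x1 x2 => B x1 x2 z) t.
have bF : balanced F.
  split=> [t t' z|t z z'|a t z]; rewrite /F.
  - exact: tliftD.
  - rewrite /tlift -big_split; apply: eq_bigr => p _.
    by have [_ -> _] := br p.1.
  - rewrite [LHS](tlift_scale _ _ (bl z)); apply: eq_bigr => p _.
    by have [_ _ ->] := bl z; have [_ _ ->] := br p.1.
have := congr1 (tlift F) (comulA c); rewrite !tlift_tlift //.
under eq_tlift => x z do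
  (rewrite tlift_tlift //;
   under eq_tlift => u v do rewrite tlift_tens // /F tlift_tens //).
move=> ->; apply: eq_tlift => x z; rewrite tlift_tlift //.
by apply: eq_tlift => u v; rewrite tlift_tens // /F tlift_tens.
Qed.

End Coassociativity.

Lemma antipodeZ (R : comNzRingType) (H : hopfAlgType R) a (x : H) :
  antipode (a *: x) = a *: antipode x.
Proof. exact: linearZ_LR. Qed.

(** Strips outer Sweedler sums and pulls additions and scalars out; what it leaves to the caller is
    a reordering of scalars. *)
Ltac balanced_tac :=
  repeat (apply: balanced_tlift => ? ?);
  split=> *; rewrite ?(mulrDl, mulrDr, linearD, scalerDl, scalerDr) //;
  rewrite ?(antipodeZ, scalarZ) -?(scalerAl, scalerAr) ?(antipodeZ, scalarZ)
          -?(scalerAl, scalerAr) //.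

(** * The antipode reverses products *)

Section HopfAlgebraTheory.
Variables (R : comNzRingType) (H : hopfAlgType R).
Implicit Types x y z : H.
Notation S := (@antipode R H).

Lemma comulM_tlift (W : zmodType) (B : H -> H -> W) x y : balanced B ->
  tlift B (comul (x * y)) =
  \sweedler_(x1, x2 <- comul x) \sweedler_(y1, y2 <- comul y)
     B (x1 * y1) (x2 * y2).
Proof.
move=> bB; rewrite comulM tlift_tlift //; apply: eq_tlift => x1 x2.
by rewrite tlift_tlift //; apply: eq_tlift => y1 y2; rewrite tlift_tens.
Qed.

Lemma comul1_tlift (W : zmodType) (B : H -> H -> W) : balanced B ->
  tlift B (comul 1) = B 1 1.
Proof. by move=> bB; rewrite comul1 tlift_tens. Qed.

(** Coassociativity groups the first two legs, which collapse to the counit, and the third leg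
    absorbs it. Both pairs (S, id) and (id, S) occur below. *)
Lemma conv_cancell (f g : {linear H -> H}) (W : zmodType) (B : H -> H -> W) x :
    (forall y, \sweedler_(y1, y2 <- comul y) f y1 * g y2 = (counit y)%:A) ->
    balanced B ->
  \sweedler_(x1, y <- comul x) \sweedler_(x2, x3 <- comul y)
     B (f x1 * g x2) x3 = B 1 x.
Proof.
move=> fg bB; have [BDl BDr BZ] := bB; rewrite -coassoc; last first.
- move=> z; split=> [u u' v|u v v'|a u v].
  + by rewrite linearD mulrDr BDl.
  + by rewrite BDr.
  + by rewrite (linearZ_LR g) -scalerAr BZ.
- move=> z; split=> [u u' v|u v v'|a u v].
  + by rewrite linearD mulrDl BDl.
  + by rewrite linearD mulrDr BDl.
  + by rewrite (linearZ_LR f) (linearZ_LR g) -scalerAl -scalerAr.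
under eq_tlift => u v do
  rewrite -(balanced_tliftl (fun a b => f a * g b) (comul u) v bB) fg BZ.
by rewrite -balanced_tliftr // comul_counitl.
Qed.

Lemma antipode_cancelr (W : zmodType) (B : H -> H -> W) x : balanced B ->
  \sweedler_(y, x3 <- comul x) \sweedler_(x1, x2 <- comul y)
     B x1 (x2 * S x3) = B x 1.
Proof.
move=> bB; have [BDl BDr BZ] := bB; rewrite coassoc; first last.
- move=> z; split=> [u u' v|u v v'|a u v].
  + by rewrite mulrDl BDr.
  + by rewrite linearD mulrDr BDr.
  + by rewrite linearZ -scalerAl -scalerAr.
- move=> z; split=> [u u' v|u v v'|a u v].
  + by rewrite BDl.
  + by rewrite mulrDl BDr.
  + by rewrite -scalerAl BZ.
under eq_tlift => u v do
  rewrite -(balanced_tliftr (fun a b => a * S b) (comul v) u bB) antipoder -BZ.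
by rewrite -balanced_tliftl // comul_counitr.
Qed.

Lemma antipode1 : S 1 = 1.
Proof.
have bB : balanced (fun u v : H => S u * v) by balanced_tac.
by have := antipodel (1 : H); rewrite comul1_tlift // mulr1 counit1 scale1r.
Qed.

(** Inserting x2 S(x3) and y2 S(y3) gives S(xy) = sum S(x1 y1) x2 y2 S(y3) S(x3), where S(x1 y1) x2
    y2 contracts to the counit because Delta is multiplicative. *)
Lemma antipodeM x y : S (x * y) = S y * S x.
Proof.
have bx : balanced (fun u v => S (u * y) * v) by balanced_tac.
have by_ x1 x2 x3 : balanced (fun u v => S (x1 * u) * (x2 * v * S x3)).
  by balanced_tac.
rewrite -[LHS]mulr1 -(antipode_cancelr x bx).
transitivity (\sweedler_(x', x3 <- comul x) \sweedler_(y', y3 <- comul y)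
   \sweedler_(a, b <- comul (x' * y')) S a * b * (S y3 * S x3)).
  apply: eq_tlift => x' x3.
  under [RHS]eq_tlift => y' y3.
    rewrite comulM_tlift; last by balanced_tac.
    over.
  rewrite exchange_tlift; apply: eq_tlift => x1 x2.
  rewrite -[x2 in LHS]mulr1 -(antipode_cancelr y (by_ _ _ _)).
  by do 2!apply: eq_tlift => ? ?; rewrite !mulrA.
transitivity (\sweedler_(x', x3 <- comul x) \sweedler_(y', y3 <- comul y)
    S (counit y' *: y3) * S (counit x' *: x3)).
  do 2!apply: eq_tlift => ? ?.
  rewrite -mulr_tliftl antipodel counitM.
  by rewrite !antipodeZ -!scalerAl mul1r -scalerAr scalerA mulrC.
under eq_tlift => x' x3 do rewrite -mulr_tliftl -raddf_tlift comul_counitl.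
by rewrite -mulr_tliftr -raddf_tlift comul_counitl.
Qed.

(** * Invariant functionals and their shift formulas *)

Section Integrals.
Variable phi : {scalar H}.

Definition left_integral : Prop :=
  forall x, \sweedler_(x1, x2 <- comul x) phi x2 *: x1 = (phi x)%:A.

Definition right_integral : Prop :=
  forall x, \sweedler_(x1, x2 <- comul x) phi x1 *: x2 = (phi x)%:A.

(** Both sides equal sum phi(x3 y2) S(x1) x2 y1: by invariance at x2 y on the left, by cancelling
    S(x1) x2 on the right. *)
Lemma left_integral_shift x y : left_integral ->
  \sweedler_(x1, x2 <- comul x) phi (x2 * y) *: S x1 =
  \sweedler_(y1, y2 <- comul y) phi (x * y2) *: y1.
Proof.
move=> phil.
have bB : balanced (fun u v =>
    \sweedler_(y1, y2 <- comul y) phi (v * y2) *: (u * y1)).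
  by balanced_tac; rewrite !scalerA mulrC.
have /= := @conv_cancell S idfun _ _ x (@antipodel _ _) bB.
under [RHS]eq_tlift do rewrite mul1r.
move=> <-; apply: eq_tlift => x1 x2.
have bm : balanced (fun u v => phi v *: (S x1 * u)).
  by balanced_tac; rewrite !scalerA mulrC.
rewrite -[S x1 in LHS]mulr1 scalerAr -phil mulr_tliftr.
under eq_tlift do rewrite -scalerAr.
rewrite comulM_tlift //.
by do 2!apply: eq_tlift => ? ?; rewrite mulrA.
Qed.

(** Mirror argument: both sides equal sum phi(x1 y1) x2 y2 S(y3). *)
Lemma right_integral_shift x y : right_integral ->
  \sweedler_(x1, x2 <- comul x) phi (x1 * y) *: x2 =
  \sweedler_(y1, y2 <- comul y) phi (x * y1) *: S y2.
Proof.
move=> phir.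
have bB : balanced (fun u v =>
    \sweedler_(x1, x2 <- comul x) phi (x1 * u) *: (x2 * v)).
  by balanced_tac; rewrite !scalerA mulrC.
have := antipode_cancelr y bB.
under [RHS]eq_tlift do rewrite mulr1.
move=> <-; apply: eq_tlift => y1 y2.
have bm : balanced (fun u v => phi u *: (v * S y2)).
  by balanced_tac; rewrite !scalerA mulrC.
rewrite -[S y2 in RHS]mul1r scalerAl -phir mulr_tliftl.
under [RHS]eq_tlift do rewrite -scalerAl.
rewrite comulM_tlift // exchange_tlift.
by do 2!apply: eq_tlift => ? ?; rewrite mulrA.
Qed.

End Integrals.

(** * Invariance of the normal integral *)

Section NormalIntegralInvariance.
Variable phi : {scalar H}.
Hypothesis phiP : normal_integral phi.

(** Since Delta(D) lies in D \ox D for a subcoalgebra D, both legs of Delta(x) stay in the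
    complement of the scalars, where [B] vanishes. *)
Lemma comul_other_simple_sum (W : zmodType) (B : H -> H -> W) x :
    balanced B -> other_simple_sum x ->
    (forall u v, other_simple_sum u -> other_simple_sum v -> B u v = 0) ->
  tlift B (comul x) = 0.
Proof.
move=> bB [s [-> s_simple]] B0.
rewrite (raddf_sum (@comul R H)) tlift_sum //; apply: big1_seq => y /=.
move=> /s_simple[D [sD Dunit Dy]].
have otherD z : D z -> other_simple_sum z.
  move=> Dz; exists [:: z]; split=> [|t]; rewrite ?big_seq1 // inE => /eqP->.
  by exists D.
have [[_ _ /(_ _ Dy)[t [tD ->]]] _ _] := sD.
rewrite tlift_sum_tens //; apply: big1_seq => p /=.
by move=> /tD[Dp1 Dp2]; apply: B0; apply: otherD.
Qed.

(** Split x into phi(x) 1 and an element of the complement; only the first contributes. The two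
    choices of [B] below give left and right invariance. *)
Lemma comul_normal_integral (B : H -> H -> H) x :
    balanced B -> B 1 1 = 1 ->
    (forall u v, other_simple_sum u -> other_simple_sum v -> B u v = 0) ->
    (forall a u v, B (a *: u) v = a *: B u v) ->
  tlift B (comul x) = (phi x)%:A.
Proof.
move=> bB B11 B0 BZ; have [_ _ /(_ x) x_phi] := phiP.
rewrite -{1}[x](subrK (phi x)%:A) linearD tliftD //.
rewrite comul_other_simple_sum // add0r (linearZ_LR comul) comul1.
by rewrite scale_tens tlift_tens // BZ B11.
Qed.

Lemma normal_integral_left : left_integral phi.
Proof.
have [phi1 phi0 _] := phiP => x.
apply: comul_normal_integral.
- by balanced_tac; rewrite !scalerA mulrC.
- by rewrite phi1 scale1r.
- by move=> u v _ /phi0->; rewrite scale0r.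
- by move=> a u v; rewrite !scalerA mulrC.
Qed.

Lemma normal_integral_right : right_integral phi.
Proof.
have [phi1 phi0 _] := phiP => x.
apply: comul_normal_integral.
- by balanced_tac; rewrite !scalerA mulrC.
- by rewrite phi1 scale1r.
- by move=> u v /phi0->; rewrite scale0r.
- by move=> a u v; rewrite scalarZ scalerA.
Qed.

End NormalIntegralInvariance.

End HopfAlgebraTheory.

(** * Nondegeneracy of the integral and the Nakayama automorphism *)

Section Nakayama.
Variables (K : fieldType) (H : hopfAlgType K) (phi : {scalar H}).
Hypotheses (phi1 : phi 1 = 1) (phil : left_integral phi).
Hypothesis phir : right_integral phi.
Notation S := (@antipode K H).

Lemma counitZ a (x : H) : counit (a *: x) = a * counit x.
Proof. exact: scalarZ. Qed.

(** The left shift gives sum phi(w u2) u1 = sum phi(w2 u) S(w1) = 0 for all w, the input of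
    [tensor_sum_ker] for the functionals phi(w _). *)
Lemma comul_integral_radical u : (forall w, phi (w * u) = 0) ->
  exists2 s : seq (H * H), comul u = \sum_(p <- s) p.1 \ox p.2 &
    forall p, p \in s -> forall w, phi (w * p.2) = 0.
Proof.
move=> u0; rewrite [comul u]tensor_sum.
apply: (@tensor_sum_ker _ _ _ _ (fun w => phi \o (w \*o idfun))) => w /=.
transitivity (\sweedler_(u1, u2 <- comul u) phi (w * u2) *: u1); first by [].
rewrite -left_integral_shift //; apply: big1 => p _.
by rewrite u0 scale0r.
Qed.

(* The radical is a left ideal containing all the u2, so it contains
   S(u1) u2 = eps(u); as phi(1) = 1, eps vanishes on it. *)
Lemma integral_nondegenerate u : (forall w, phi (w * u) = 0) -> u = 0.
Proof.
have counit0 v : (forall w, phi (w * v) = 0) -> counit v = 0.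
  move=> /comul_integral_radical[s vE s0].
  rewrite -[LHS]mulr1 -phi1 -scalarZ -antipodel vE tlift_sum_tens; last first.
    by balanced_tac.
  by rewrite raddf_sum /=; apply: big1_seq => p /= /s0.
move=> /comul_integral_radical[s uE s0].
rewrite -[u]comul_counitr uE tlift_sum_tens; last first.
  by balanced_tac; rewrite !scalerA mulrC.
by apply: big1_seq => p /= /s0/counit0->; rewrite scale0r.
Qed.

Lemma integral_inj u v : (forall w, phi (w * u) = phi (w * v)) -> u = v.
Proof.
move=> uv; apply/subr0_eq/integral_nondegenerate => w.
by rewrite mulrBr linearB /= uv subrr.
Qed.

(** The right shift and left invariance give sum phi(w x1) phi(S(x2)) = sum phi(w1 x) phi(w2) =
    phi(w) phi(x). Removing the test by w yields [E], and the counit turns [E] into the claim. *)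
Lemma integral_antipode x : phi (S x) = phi x.
Proof.
have E : \sweedler_(x1, x2 <- comul x) phi (S x2) *: x1 = (phi x)%:A.
  apply: integral_inj => w; rewrite scalar_mulr_tlift eq_tliftC -scalar_tlift.
  rewrite -right_integral_shift // scalar_tlift eq_tliftC -scalerAr mulr1.
  rewrite scalarZ.
  under eq_tlift do rewrite -scalarZ scalerAl.
  rewrite -(raddf_tlift phi) -mulr_tliftl phil -scalerAl mul1r /=.
  by rewrite scalarZ mulrC.
have := congr1 counit E; rewrite scalar_tlift counitZ counit1 mulr1 => <-.
rewrite eq_tliftC.
under eq_tlift do rewrite -scalarZ -antipodeZ.
by rewrite -!raddf_tlift comul_counitl.
Qed.

Variable N : {lrmorphism H -> H}.
Hypothesis NP : nakayama phi N.

Let alpha (x : H) : K := counit (N x).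
Let phiN x y : phi (x * y) = phi (y * N x) := NP.2 x y.

(** Underneath lies Delta(N(x)) = sum S^2(x1) \ox N(x2), whose second leg is then hit by the
    counit. *)
Lemma nakayama_convr x :
  N x = \sweedler_(x1, x2 <- comul x) alpha x2 *: S (S x1).
Proof.
(* The identity with its second leg tested by phi(y _): two left shifts, with phi(a b) = phi(b N(a))
   used between them and at the end. *)
have E y : \sweedler_(x1, x2 <- comul x) phi (y * N x2) *: S (S x1) =
    \sweedler_(n1, n2 <- comul (N x)) phi (y * n2) *: n1.
  rewrite -left_integral_shift //.
  under [RHS]eq_tlift do rewrite -phiN -antipodeZ.
  rewrite -raddf_tlift -left_integral_shift // raddf_tlift.
  by apply: eq_tlift => ? ? /=; rewrite antipodeZ -phiN.
apply: integral_inj => w.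
(* Testing the first leg by w as well lets nondegeneracy remove y, which frees the second leg for
   the counit. *)
have F : \sweedler_(x1, x2 <- comul x) phi (w * S (S x1)) *: N x2 =
    \sweedler_(n1, n2 <- comul (N x)) phi (w * n1) *: n2.
  apply: integral_inj => y; have := congr1 (fun z => phi (w * z)) (E y).
  by rewrite !scalar_mulr_tlift eq_tliftC [in RHS]eq_tliftC.
have := congr1 counit F.
rewrite scalar_mulr_tlift !scalar_tlift eq_tliftC => ->.
by rewrite eq_tliftC -scalar_mulr_tlift comul_counitr.
Qed.

(** Same method with right shifts: if Delta(N(x)) = sum n1 \ox n2, then sum N(x1) \ox x2 = sum n1
    \ox S^2(n2), and the counit goes to the first leg. *)
Lemma nakayama_convl x :
  S (S (N x)) = \sweedler_(x1, x2 <- comul x) alpha x1 *: x2.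
Proof.
have E y : \sweedler_(x1, x2 <- comul x) phi (y * N x1) *: x2 =
    \sweedler_(n1, n2 <- comul (N x)) phi (y * n1) *: S (S n2).
  under eq_tlift do rewrite -phiN.
  rewrite right_integral_shift //.
  under eq_tlift do rewrite phiN -antipodeZ.
  rewrite -raddf_tlift right_integral_shift // raddf_tlift.
  by apply: eq_tlift => ? ? /=; rewrite antipodeZ.
apply: integral_inj => w.
have F : \sweedler_(x1, x2 <- comul x) phi (w * x2) *: N x1 =
    \sweedler_(n1, n2 <- comul (N x)) phi (w * S (S n2)) *: n1.
  apply: integral_inj => y; have := congr1 (fun z => phi (w * z)) (E y).
  by rewrite !scalar_mulr_tlift eq_tliftC [in RHS]eq_tliftC.
have := congr1 counit F.
rewrite scalar_mulr_tlift !scalar_tlift eq_tliftC => ->.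
rewrite eq_tliftC -scalar_mulr_tlift.
under eq_tlift do rewrite -!antipodeZ.
by rewrite -!raddf_tlift comul_counitl.
Qed.

(** For w = S(v), phi(S(N(x)) w) = phi(S(v N(x))) = phi(v N(x)) = phi(x v) = phi(S(x v)) = phi(w
    S(x)). *)
Lemma antipode_nakayama Sinv x : cancel Sinv S -> N (S (N x)) = S x.
Proof.
move=> SinvK; apply: integral_inj => w.
by rewrite -phiN -[w]SinvK -!antipodeM !integral_antipode -phiN.
Qed.

End Nakayama.

(** * The conjugate linear involution against counit and antipode *)

Section CircCoalgebraTheory.
Variables (K : numClosedFieldType) (C : circCoalgebraType K).
Implicit Types x : C.

Lemma circ0 : circ (0 : C) = 0.
Proof. by rewrite -[X in circ X](scale0r 0) circZ conjC0 scale0r. Qed.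

(** Being conjugate linear, [circ] passes through Sweedler sums by its additivity. *)
HB.instance Definition _ := GRing.isNmodMorphism.Build C C (@circ K C)
  (conj circ0 (@circD K C)).

Lemma comul_circ_tlift (W : zmodType) (B : C -> C -> W) x : balanced B ->
  tlift B (comul (x^circ)) =
  \sweedler_(x1, x2 <- comul x) B (x2^circ) (x1^circ).
Proof.
move=> bB; rewrite comul_circ tlift_tlift //.
by apply: eq_tlift => u v; rewrite tlift_tens.
Qed.

(** As [circ] flips Delta, x |-> conj(eps(x^circ)) is again a left counit, and a left counit agrees
    with the right counit eps. *)
Lemma counit_circ x : counit (x^circ) = (counit x)^*.
Proof.
have bB : balanced (fun u v : C => counit v *: u).
  by balanced_tac; rewrite !scalerA mulrC.
have E : \sweedler_(x1, x2 <- comul x) (counit (x1^circ))^* *: x2 = x.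
  apply: (can_inj circK).
  rewrite -[RHS]comul_counitr comul_circ_tlift // raddf_tlift.
  by apply: eq_tlift => u v /=; rewrite circZ conjCK.
rewrite -[x in LHS]comul_counitr -[x in RHS]E scalar_tlift !raddf_tlift.
by apply: eq_tlift => u v /=; rewrite circZ scalarZ rmorphM /= conjCK mulrC.
Qed.

End CircCoalgebraTheory.

Section CircHopfTheory.
Variables (K : numClosedFieldType) (H : circHopfAlgType K).
Implicit Types x y : H.
Notation S := (@antipode K H).

Lemma circ1 : circ (1 : H) = 1.
Proof. by rewrite -[circ 1]mulr1 -[X in _ * X]circK -circM mul1r circK. Qed.

(** Put T(x) = S((S(x^circ))^circ). Then S * T is the convolution unit by [E], so T = (id * S) * T =
    id * (S * T) = id. *)
Lemma antipode_circ x : S ((S (x^circ))^circ) = x.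
Proof.
have bS : balanced (fun u v : H => S u * v) by balanced_tac.
have E y : \sweedler_(y1, y2 <- comul y) S y1 * S ((S (y2^circ))^circ) =
    (counit y)%:A.
  under eq_tlift => y1 y2 do
    rewrite -antipodeM -[X in _ * X]circK -circM.
  rewrite -(raddf_tlift S) -(raddf_tlift (@circ K H)) /=.
  rewrite -(comul_circ_tlift _ bS) antipodel counit_circ circZ.
  by rewrite circ1 conjCK antipodeZ antipode1.
have bB : balanced (fun u v : H => u * S ((S (v^circ))^circ)).
  split=> [*|u v v'|a u v]; first exact: mulrDl.
    by rewrite circD linearD circD linearD mulrDr.
  by rewrite circZ antipodeZ circZ conjCK antipodeZ -scalerAl -scalerAr.
rewrite -[LHS]mul1r.
have /= <- := @conv_cancell _ H idfun S _ _ x (@antipoder _ _) bB.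
transitivity (\sweedler_(x1, y <- comul x) x1 * (counit y)%:A).
  apply: eq_tlift => x1 y; rewrite -E mulr_tliftr.
  by apply: eq_tlift => *; rewrite mulrA.
by under eq_tlift do rewrite -scalerAr mulr1; rewrite comul_counitr.
Qed.

Lemma antipode_bij : bijective S.
Proof.
exists (fun x => (S (x^circ))^circ) => x; last exact: antipode_circ.
by apply: (can_inj circK); rewrite circK -[RHS]antipode_circ circK.
Qed.

(** * The adjoint of the antipode *)

Section Integral.
Variable phi : {scalar H}.
Hypotheses (phi1 : phi 1 = 1) (phil : left_integral phi).
Hypothesis phir : right_integral phi.

(** The functional psi(x) = conj(phi(x^circ)) is left invariant by [E]; evaluating sum phi(x1)
    psi(x2) through either invariance gives psi = phi. *)
Lemma integral_circ x : phi (x^circ) = (phi x)^*.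
Proof.
have bB : balanced (fun u v : H => phi u *: v).
  by balanced_tac; rewrite !scalerA mulrC.
have E : \sweedler_(x1, x2 <- comul x) (phi (x2^circ))^* *: x1 =
    (phi (x^circ))^*%:A.
  apply: (can_inj circK); rewrite circZ conjCK circ1 -phir comul_circ_tlift //.
  by rewrite raddf_tlift; apply: eq_tlift => u v /=; rewrite circZ conjCK.
apply: (can_inj conjCK); rewrite conjCK.
rewrite -[LHS]mulr1 -phi1 -scalarZ -E scalar_tlift.
transitivity (phi ((\sweedler_(x1, x2 <- comul x) phi x1 *: x2)^circ))^*.
  rewrite !raddf_tlift; apply: eq_tlift => u v /=.
  by rewrite circZ scalarZ rmorphM /= conjCK mulrC.
by rewrite phir circZ circ1 scalarZ phi1 mulr1 conjCK.
Qed.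

Variable N : {lrmorphism H -> H}.
Hypothesis NP : nakayama phi N.

Lemma nakayama_circ x : N (x^circ) = (N x)^circ.
Proof.
have phiN := NP.2; apply: (integral_inj phi1 phil) => w.
by rewrite -phiN -[w]circK -!circM !integral_circ // phiN.
Qed.

(** The left side of the adjunction is phi(S(x y^circ)) = phi(x y^circ), the right side is phi(x
    N(S((T y)^circ))). By [NSE] they agree for T = N S. *)
Lemma adjoint_antipode (T : H -> H) :
  adjoint (circ_product phi) S T <-> T =1 N \o S.
Proof.
have phiN := NP.2; have [Sinv SK SinvK] := antipode_bij.
have [Ninv NK _] := NP.1.
have SxE x y : circ_product phi (S x) y = phi (y^circ * N x).
  by rewrite /circ_product -antipodeM integral_antipode // phiN.
have xE x y : circ_product phi x y = phi (x * N (S (y^circ))).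
  by rewrite /circ_product phiN.
have NSE y : N (S ((N (S y))^circ)) = y^circ.
  rewrite -nakayama_circ (antipode_nakayama phi1 phil phir NP _ SinvK).
  by rewrite -[RHS]antipode_circ circK.
split=> [adjT y|TE x y]; last by rewrite SxE xE TE /= NSE -phiN.
(* Uniqueness: phi is nondegenerate, and N, S and [circ] are injective. *)
apply: (can_inj circK); apply: (can_inj SK); apply: (can_inj NK).
apply: (integral_inj phi1 phil) => x.
by rewrite -xE -adjT SxE /= NSE -phiN.
Qed.

End Integral.
End CircHopfTheory.

(** By coassociativity both sides are sum x1 tau(x2) sigma(x3); hence inverse functionals yield
    inverse operators. *)
Lemma convr_id_comp (R : comNzRingType) (C : coalgebraType R)
    (tau sigma : {scalar C}) (x : C) :
  convr id tau (convr id sigma x) = convr id (conv tau sigma) x.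
Proof.
have bB : balanced (fun u v : C => tau v *: u).
  by balanced_tac; rewrite !scalerA mulrC.
rewrite /convr raddf_tlift tlift_tlift //=.
transitivity (\sweedler_(x1, x2 <- comul x) \sweedler_(y1, y2 <- comul x1)
    tau y2 *: (sigma x2 *: y1)).
  by apply: eq_tlift => x1 x2; rewrite linearZ tlift_scale.
rewrite coassoc; first last.
- by move=> z; balanced_tac; rewrite !scalerA -mulrA mulrCA.
- by move=> z; balanced_tac; rewrite !scalerA mulrC mulrA.
apply: eq_tlift => x1 x2; rewrite scaler_tliftl.
by apply: eq_tlift => *; rewrite scalerA.
Qed.

(** Recovers a functional from its convolution operator, so that equal operators yield equal
    functionals. *)
Lemma counit_convr (R : comNzRingType) (C : coalgebraType R)
    (tau : {scalar C}) (x : C) : counit (convr id tau x) = tau x.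
Proof.
rewrite scalar_tlift eq_tliftC -scalar_tlift; congr (tau _).
exact: comul_counitl.
Qed.

Lemma counit_convl (R : comNzRingType) (C : coalgebraType R)
    (tau : {scalar C}) (x : C) : counit (convl tau id x) = tau x.
Proof.
rewrite scalar_tlift eq_tliftC -scalar_tlift; congr (tau _).
exact: comul_counitr.
Qed.

(** * Adjoint formulas and the normality criterion *)

Theorem lemma8p13 (R : realType) (H : compactQuantumGroupType R[i])
    (phi : {scalar H}) (N : {lrmorphism H -> H})
    (phiP : normal_integral phi) (NP : nakayama phi N) :
  let S : H -> H := antipode in
  let Sinv : H -> H := inverse S in
  let Ninv : H -> H := inverse N in
  let eps : H -> R[i] := counit in
  let alpha : H -> R[i] := eps \o N in
  let alphainv : H -> R[i] := alpha \o S in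
  bijective S /\
  exists Sadj : H -> H,
    [/\ forall T : H -> H, adjoint (circ_product phi) S T <-> T =1 Sadj,
        [/\ Sadj =1 S \o Ninv, Sadj =1 N \o S & Sadj =1 convr Sinv alphainv],
        [/\ S \o Sadj =1 S \o S \o Ninv,
            S \o Sadj =1 Ninv \o S \o S &
            S \o Sadj =1 convr id alphainv] /\
        [/\ Sadj \o S =1 N \o S \o S,
            Sadj \o S =1 S \o S \o N &
            Sadj \o S =1 convl alpha id] &
        S \o Sadj =1 Sadj \o S <->
        S \o S \o S \o S =1 id /\ conv alpha alpha =1 eps].
Proof.
move=> S Sinv Ninv eps alpha alphainv.
have [phi1 _ _] := phiP.
have phil := normal_integral_left phiP; have phir := normal_integral_right phiP.
have Sbij : bijective S by exact: antipode_bij.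
have [SK SinvK] : cancel S Sinv /\ cancel Sinv S := inverseK Sbij.
have [NK NinvK] : cancel N Ninv /\ cancel Ninv N := inverseK NP.1.
have NSN x : N (S (N x)) = S x.
  by have := antipode_nakayama phi1 phil phir NP x SinvK.
(* N S N = S lets N cross S at the price of an inversion, which links the various forms of the
   adjoint and of its products with S. *)
have NS x : N (S x) = S (Ninv x) by rewrite -[x in LHS]NinvK NSN.
have SN x : S (N x) = Ninv (S x) by rewrite -[LHS]NK NSN.
have SSN x : S (S (N x)) = convl alpha id x.
  by rewrite /S (nakayama_convl phi1 phil phir NP x).
pose P := convr id alpha; pose Q := convr id alphainv.
have NE x : N x = S (S (P x)).
  rewrite (nakayama_convr phi1 phil NP) /S /P /convr 2!raddf_tlift.
  by apply: eq_tlift => u v /=; rewrite !antipodeZ.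
have convr_eps x : convr id eps x = x by exact: comul_counitr.
have PQ x : P (Q x) = x.
  have -> : P (Q x) = convr id (conv alpha alphainv) x :=
    convr_id_comp (counit \o N) (counit \o N \o antipode) x.
  rewrite -[RHS]convr_eps; apply: eq_tlift => u v.
  by rewrite (modular_convV N v).1.
(* Here N = S^2 P and P Q = id give S N S = N^-1 S^2 P Q = Q. *)
have SNS x : S (N (S x)) = Q x.
  by rewrite SN -[in LHS](PQ x) -NE NK.
split=> //; exists (N \o S); split.
- exact: adjoint_antipode.
- split=> // x /=; apply: (can_inj SK); rewrite SNS /S /Q /convr raddf_tlift.
  by apply: eq_tlift => u v /=; rewrite antipodeZ [antipode _]SinvK.
- split; split=> // x /=; first by rewrite NS.
  + by rewrite SN.
  + by rewrite NS -SN.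
  + by rewrite NS -SN SSN.
split=> [SNSE|[S4 alpha2]].
(* Normality reads id * alpha^-1 = alpha * id; the counit then gives alpha^-1 = alpha, that is Q =
   P. *)
- have QE x : Q x = convl alpha id x.
    by rewrite -SSN SN -NS -[LHS]SNS; exact: SNSE.
  have alphaE x : alphainv x = alpha x.
    rewrite -[LHS](counit_convr (counit \o N \o antipode)).
    rewrite -[RHS](counit_convl (counit \o N)).
    exact: (congr1 counit (QE x)).
  have QP x : Q x = P x by apply: eq_tlift => u v; rewrite alphaE.
  split=> x /=; last first.
    rewrite -[RHS](modular_convV N x).1.
    by apply: eq_tlift => u v; congr (_ * _); rewrite [RHS]alphaE.
  (* Every x is N(z), and S^4 N(z) = S^2 Q(z) = S^2 P(z) = N(z). *)
  by rewrite -[x]NinvK SSN -QE QP -NE.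
(* Conversely alpha^2 = eps makes P an involution, so Q = P, while the other product is S^2 N = S^4
   P = P. *)
have PP x : P (P x) = x.
  have -> : P (P x) = convr id (conv alpha alpha) x :=
    convr_id_comp (counit \o N) (counit \o N) x.
  by rewrite -[RHS]convr_eps; apply: eq_tlift => u v; rewrite alpha2.
have QP x : Q x = P x by rewrite -[LHS]PP PQ.
by move=> x /=; rewrite SNS QP NS -SN NE; apply/esym/S4.
Qed.
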